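(* Let $\Gamma$ be a context, $\sigma$ a type, and $t,u$ QML terms with $\Gamma\vdash t,u:\sigma$ whose meanings $[\![\Gamma\vdash t:\sigma]\!]^{\mathrm Q}$ and $[\![\Gamma\vdash u:\sigma]\!]^{\mathrm Q}$ are morphisms of $\mathbf Q^\circ$ (isometries). If $\Gamma\vdash t\equiv u:\sigma$ is derivable in the quantum equational theory, then the isometries $[\![\Gamma\vdash t:\sigma]\!]^{\mathrm Q}$ and $[\![\Gamma\vdash u:\sigma]\!]^{\mathrm Q}$ are extensionally equal.
   Context: **Syntax.** Types: $\sigma::=\mathcal Q_1\mid\mathcal Q_2\mid\sigma\otimes\tau$. Patterns: $p::=x\mid(x,y)$. Terms ($\kappa\in\mathbb C$): $t,u,e::=x\mid()\mid(t,u)\mid\mathbf{let}\ p=t\ \mathbf{in}\ u\mid\mathbf{if}^\circ\ t\ \mathbf{then}\ u\ \mathbf{else}\ u'\mid\mathrm{false}\mid\mathrm{true}\mid\overrightarrow 0\mid\kappa*t\mid t+u$. Contexts: $\Gamma::=\bullet\mid\Gamma,x:\sigma$, each variable at most once (finite functions from variables to types). The partial operation $\Gamma\otimes\Delta$ merges contexts, identifying shared variables (which must have equal types): $(\Gamma,x:\sigma)\otimes(\Delta,x:\sigma)=(\Gamma\otimes\Delta),x:\sigma$; $(\Gamma,x:\sigma)\otimes\Delta=(\Gamma\otimes\Delta),x:\sigma$ if $x\notin\mathrm{dom}(\Delta)$; $\bullet\otimes\Delta=\Delta$. It is assumed defined whenever used. **Typing rules** for $\Gamma\vdash t:\sigma$: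 - $x:\sigma\vdash x:\sigma$; $\bullet\vdash():\mathcal Q_1$; $\bullet\vdash\mathrm{false}:\mathcal Q_2$; $\bullet\vdash\mathrm{true}:\mathcal Q_2$; $\bullet\vdash\overrightarrow 0:\sigma$. - from $\Gamma\vdash t:\sigma$ and $\Delta,x:\sigma\vdash u:\tau$ infer $\Gamma\otimes\Delta\vdash\mathbf{let}\ x=t\ \mathbf{in}\ u:\tau$. - from $\Gamma\vdash t:\sigma$ and $\Delta\vdash u:\tau$ infer $\Gamma\otimes\Delta\vdash(t,u):\sigma\otimes\tau$. - from $\Gamma\vdash t:\sigma\otimes\tau$ and $\Delta,x:\sigma,y:\tau\vdash u:\rho$ infer $\Gamma\otimes\Delta\vdash\mathbf{let}\ (x,y)=t\ \mathbf{in}\ u:\rho$. - from $\Gamma\vdash c:\mathcal Q_2$ and $\Delta\vdash t,u:\sigma$ infer $\Gamma\otimes\Delta\vdash\mathbf{if}^\circ\ c\ \mathbf{then}\ t\ \mathbf{else}\ u:\sigma$. - from $\Gamma\vdash t:\sigma$ infer $\Gamma\vdash\kappa*t:\sigma$; from $\Gamma\vdash t,u:\sigma$ infer $\Gamma\vdash t+u:\sigma$. - (wk-unit) from $\Gamma,x:\mathcal Q_1\vdash t:\sigma$ infer $\Gamma\vdash t:\sigma$, and conversely bindings of variables of type $\mathcal Q_1$ may be added to the context. **Semantics.** $[\![\mathcal Q_1]\!]=\{0\}$, $[\![\mathcal Q_2]\!]=\{0,1\}$, $[\![\sigma\otimes\tau]\!]=[\![\sigma]\!]\times[\![\tau]\!]$;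 $|\bullet|=\mathcal Q_1$, $|\Gamma,x:\sigma|=|\Gamma|\otimes\sigma$, $[\![\Gamma]\!]=[\![\,|\Gamma|\,]\!]$. $[\![\sigma]\!]^{\mathrm Q}=([\![\sigma]\!]\to\mathbb C)$ with pointwise vector space structure and $\langle v|w\rangle=\sum_a\overline{v(a)}w(a)$. $\mathit{return}\,a$ is the basis vector at $a$. For $g\in[\![\Gamma\otimes\Delta]\!]$ let $(g_\Gamma,g_\Delta)\in[\![\Gamma]\!]\times[\![\Delta]\!]$ be its restrictions (values of shared variables copied). $[\![\Gamma\vdash t:\sigma]\!]^{\mathrm Q}:[\![\Gamma]\!]\to[\![\sigma]\!]^{\mathrm Q}$ is defined by induction on the derivation (writing $[\![t]\!]$): $[\![()]\!]0=\mathit{return}\,0$; $[\![\mathrm{false}]\!]0=\mathit{return}\,0$; $[\![\mathrm{true}]\!]0=\mathit{return}\,1$; $[\![x]\!](0,a)=\mathit{return}\,a$; $[\![\mathbf{let}\ x=t\ \mathbf{in}\ u]\!]g=\sum_a([\![t]\!]g_\Gamma)(a)\,[\![u]\!](g_\Delta,a)$; $([\![(t,u)]\!]g)(a,b)=([\![t]\!]g_\Gamma)(a)\,([\![u]\!]g_\Delta)(b)$; $[\![\mathbf{let}\ (x,y)=t\ \mathbf{in}\ u]\!]g=\sum_{a,b}([\![t]\!]g_\Gamma)(a,b)\,[\![u]\!]((g_\Delta,a),b)$; $[\![\mathbf{if}^\circ\ c\ \mathbf{then}\ t\ \mathbf{else}\ u]\!]g=([\![c]\!]g_\Gamma)(1)\,[\![t]\!]g_\Delta+([\![c]\!]g_\Gamma)(0)\,[\![u]\!]g_\Delta$;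 $[\![\overrightarrow 0]\!]0$ is the zero vector; $[\![\kappa*t]\!]g=\kappa[\![t]\!]g$; $[\![t+u]\!]g=[\![t]\!]g+[\![u]\!]g$; for wk-unit, $[\![\Gamma\vdash t]\!]g=[\![\Gamma,x:\mathcal Q_1\vdash t]\!](g,0)$. **Category $\mathbf Q^\circ$.** A map $f:[\![\Gamma]\!]\to[\![\sigma]\!]^{\mathrm Q}$ is a morphism of $\mathbf Q^\circ$ if its linear extension $[\![\Gamma]\!]^{\mathrm Q}\to[\![\sigma]\!]^{\mathrm Q}$ preserves inner products. **Quantum equational theory.** Values: $val::=x\mid()\mid\mathrm{false}\mid\mathrm{true}\mid(val_1,val_2)$. The equations are those of the classical theory: - $\mathbf{let}\ p=val\ \mathbf{in}\ u\equiv u[val/p]$; - $\mathbf{let}\ (x,y)=(t,u)\ \mathbf{in}\ e\equiv\mathbf{let}\ x=t\ \mathbf{in}\ \mathbf{let}\ y=u\ \mathbf{in}\ e$; $\mathbf{if}^\circ\ \mathrm{false}\ \mathbf{then}\ t\ \mathbf{else}\ u\equiv u$; $\mathbf{if}^\circ\ \mathrm{true}\ \mathbf{then}\ t\ \mathbf{else}\ u\equiv t$; - $()\equiv t$ if $t:\mathcal Q_1$; $\mathbf{let}\ x=t\ \mathbf{in}\ x\equiv t$; $\mathbf{let}\ (x,y)=t\ \mathbf{in}\ (x,y)\equiv t$; $\mathbf{if}^\circ\ t\ \mathbf{then}\ \mathrm{true}\ \mathbf{else}\ \mathrm{false}\equiv t$; - $\mathbf{let}\ p=t\ \mathbf{in}\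 \mathbf{let}\ q=u\ \mathbf{in}\ e\equiv\mathbf{let}\ q=u\ \mathbf{in}\ \mathbf{let}\ p=t\ \mathbf{in}\ e$; $\mathbf{let}\ p=(\mathbf{if}^\circ\ t\ \mathbf{then}\ u_0\ \mathbf{else}\ u_1)\ \mathbf{in}\ e\equiv\mathbf{if}^\circ\ t\ \mathbf{then}\ (\mathbf{let}\ p=u_0\ \mathbf{in}\ e)\ \mathbf{else}\ (\mathbf{let}\ p=u_1\ \mathbf{in}\ e)$; together with - $\mathbf{if}^\circ\ (\lambda*t_0+\kappa*t_1)\ \mathbf{then}\ u_0\ \mathbf{else}\ u_1\equiv\lambda*(\mathbf{if}^\circ\ t_0\ \mathbf{then}\ u_0\ \mathbf{else}\ u_1)+\kappa*(\mathbf{if}^\circ\ t_1\ \mathbf{then}\ u_0\ \mathbf{else}\ u_1)$; - $t+u\equiv u+t$; $t+\overrightarrow 0\equiv t$; $t+(u+v)\equiv(t+u)+v$; $\lambda*(t+u)\equiv\lambda*t+\lambda*u$; $\lambda*t+\kappa*t\equiv(\lambda+\kappa)*t$; $0*t\equiv\overrightarrow 0$. $\Gamma\vdash t\equiv u:\sigma$ means that $\Gamma\vdash t:\sigma$, $\Gamma\vdash u:\sigma$, and $t\equiv u$ is derivable at type $\sigma$ from these equations by equational reasoning (equivalence and congruence), with the usual conventions avoiding variable capture.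
   Formalization: The equation () ≡ t for t : Q1 is taken only for classical t (no zero vector, scaling or sum), since for arbitrary quantum t it gives () ≡ (-1)*(), whose meanings are distinct isometries. *)

(* Defs.v *)
(* MathComp *)
From HB Require Import structures.
From mathcomp Require Import all_boot all_order all_algebra.

Set Implicit Arguments.
Unset Strict Implicit.
Unset Printing Implicit Defensive.

Import GRing.Theory Num.Theory.
Local Open Scope ring_scope.

(** * Types and contexts *)

Inductive ty : Type := Q1 | Q2 | Tensor of ty & ty.

Fixpoint ty_eqb (s t : ty) : bool :=
  match s, t with
  | Q1, Q1 => true
  | Q2, Q2 => true
  | Tensor s1 s2, Tensor t1 t2 => ty_eqb s1 t1 && ty_eqb s2 t2
  | _, _ => false
  end.

Lemma ty_eqP : Equality.axiom ty_eqb.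
Proof.
elim=> [||s1 IH1 s2 IH2] [||t1 t2] /=; try by constructor.
by apply: (iffP andP) => [[/IH1-> /IH2->]|[<- <-]] //; split; [apply/IH1|apply/IH2].
Qed.

HB.instance Definition _ := hasDecEq.Build ty ty_eqP.

Definition var := nat.

(* The context "G, x : s" is the list (x, s) :: G.  Contexts are finite
   functions: the typing rules below keep the variables distinct and include
   an exchange rule, so the order of the list is irrelevant. *)
Definition ctx := seq (var * ty).

Definition dom (G : ctx) : seq var := unzip1 G.

Fixpoint lookup (G : ctx) (x : var) : option ty :=
  if G is (y, s) :: G' then if x == y then Some s else lookup G' x else None.

(* The partial operation merging two contexts. *)
Fixpoint ctx_tensor (G D : ctx) : option ctx :=
  if G is (x, s) :: G' then
    match lookup D x with
    | Some s' =>
        if s == s'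
        then omap (cons (x, s)) (ctx_tensor G' [seq b <- D | b.1 != x])
        else None
    | None => omap (cons (x, s)) (ctx_tensor G' D)
    end
  else Some D.

(** * Terms *)

Inductive pat : Type := PVar of var | PPair of var & var.

Definition pvars (p : pat) : seq var :=
  match p with PVar x => [:: x] | PPair x y => [:: x; y] end.

Inductive term (C : Type) : Type :=
  | tVar of var
  | tUnit
  | tPair of term C & term C
  | tLet of pat & term C & term C
  | tIf of term C & term C & term C
  | tFalse
  | tTrue
  | tZero
  | tScale of C & term C
  | tPlus of term C & term C.

Arguments tVar {C} _.
Arguments tUnit {C}.
Arguments tFalse {C}.
Arguments tTrue {C}.
Arguments tZero {C}.

Section Syntax.
Variable C : Type.
Implicit Types (t u : term C) (s : var -> term C).

Fixpoint fv t : seq var :=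
  match t with
  | tVar x => [:: x]
  | tUnit | tFalse | tTrue | tZero => [::]
  | tPair t u | tPlus t u => fv t ++ fv u
  | tLet p t u => fv t ++ [seq x <- fv u | x \notin pvars p]
  | tIf c t u => fv c ++ fv t ++ fv u
  | tScale _ t => fv t
  end.

Fixpoint is_val t : bool :=
  match t with
  | tVar _ | tUnit | tFalse | tTrue => true
  | tPair t u => is_val t && is_val u
  | _ => false
  end.

(* Terms of the classical sublanguage: no superposition operators. *)
Fixpoint classical t : bool :=
  match t with
  | tVar _ | tUnit | tFalse | tTrue => true
  | tPair t u | tLet _ t u => classical t && classical u
  | tIf c t u => [&& classical c, classical t & classical u]
  | tZero | tScale _ _ | tPlus _ _ => false
  end.

Definition shadow (p : pat) s : var -> term C :=
  fun x => if x \in pvars p then tVar x else s x.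

(* Simultaneous substitution.  It does not rename binders: it is only used
   together with [capture_free]. *)
Fixpoint subst s t : term C :=
  match t with
  | tVar x => s x
  | tUnit => tUnit
  | tPair t u => tPair (subst s t) (subst s u)
  | tLet p t u => tLet p (subst s t) (subst (shadow p s) u)
  | tIf c t u => tIf (subst s c) (subst s t) (subst s u)
  | tFalse => tFalse
  | tTrue => tTrue
  | tZero => tZero
  | tScale k t => tScale k (subst s t)
  | tPlus t u => tPlus (subst s t) (subst s u)
  end.

Fixpoint capture_free s t : bool :=
  match t with
  | tVar _ | tUnit | tFalse | tTrue | tZero => true
  | tPair t u | tPlus t u => capture_free s t && capture_free s u
  | tLet p t u =>
      [&& capture_free s t, capture_free (shadow p s) u &
        all (fun z => (z \in pvars p) || ~~ has (mem (pvars p)) (fv (s z)))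
            (fv u)]
  | tIf c t u => [&& capture_free s c, capture_free s t & capture_free s u]
  | tScale _ t => capture_free s t
  end.

Definition sub1 (x : var) (v : term C) : var -> term C :=
  fun z => if z == x then v else tVar z.

Definition sub2 (x y : var) (v w : term C) : var -> term C :=
  fun z => if z == x then v else if z == y then w else tVar z.

(** * Typing *)

Inductive typing : ctx -> term C -> ty -> Type :=
  | ty_var x a : typing [:: (x, a)] (tVar x) a
  | ty_unit : typing [::] tUnit Q1
  | ty_false : typing [::] tFalse Q2
  | ty_true : typing [::] tTrue Q2
  | ty_zero a : typing [::] tZero a
  | ty_let G D GD x t u a b :
      ctx_tensor G D = Some GD ->
      typing G t a -> typing ((x, a) :: D) u b ->
      typing GD (tLet (PVar x) t u) b
  | ty_pair G D GD t u a b :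
      ctx_tensor G D = Some GD ->
      typing G t a -> typing D u b ->
      typing GD (tPair t u) (Tensor a b)
  | ty_let_pair G D GD x y t u a b c :
      ctx_tensor G D = Some GD ->
      typing G t (Tensor a b) -> typing ((y, b) :: (x, a) :: D) u c ->
      typing GD (tLet (PPair x y) t u) c
  | ty_if G D GD c t u a :
      ctx_tensor G D = Some GD ->
      typing G c Q2 -> typing D t a -> typing D u a ->
      typing GD (tIf c t u) a
  | ty_scale G k t a : typing G t a -> typing G (tScale k t) a
  | ty_plus G t u a : typing G t a -> typing G u a -> typing G (tPlus t u) a
  | ty_wk_unit G x t a : typing ((x, Q1) :: G) t a -> typing G t a
  | ty_wk_unit_inv G x t a :
      x \notin dom G -> typing G t a -> typing ((x, Q1) :: G) t a
  | ty_exch G G' t a : perm_eq G G' -> typing G t a -> typing G' t a.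

End Syntax.

(** * Semantics *)

(* [[Q1]] = {0} is [unit]; [[Q2]] = {0, 1} is [bool], with 1 = true. *)
Fixpoint den (a : ty) : finType :=
  match a with
  | Q1 => unit
  | Q2 => bool
  | Tensor a b => (den a * den b)%type
  end.

Fixpoint ctx_ty (G : ctx) : ty :=
  if G is (_, a) :: G' then Tensor (ctx_ty G') a else Q1.

Fixpoint den_default (a : ty) : den a :=
  match a return den a with
  | Q1 => tt
  | Q2 => false
  | Tensor a b => (den_default a, den_default b)
  end.

Definition den_cast (a b : ty) : den a -> den b :=
  match a =P b with
  | ReflectT e => fun v => ecast c (den c) e v
  | ReflectF _ => fun=> den_default b
  end.

(* The value of x in an environment for G.  The default value is only reached
   when G does not bind x to the type a, which never happens in [sem]. *)
Fixpoint env_get (G : ctx) (x : var) (a : ty) : den (ctx_ty G) -> den a :=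
  match G return den (ctx_ty G) -> den a with
  | [::] => fun=> den_default a
  | (y, b) :: G' => fun g =>
      if x == y then @den_cast b a g.2 else @env_get G' x a g.1
  end.

(* Restriction of an environment for G to the subcontext D. *)
Fixpoint restr (G D : ctx) (g : den (ctx_ty G)) : den (ctx_ty D) :=
  match D return den (ctx_ty D) with
  | [::] => tt
  | (x, a) :: D' => (restr D' g, env_get x a g)
  end.

Section Semantics.
Variable C : numClosedFieldType.

Definition qvec (A : finType) := {ffun A -> C^o}.

Definition inner (A : finType) (v w : qvec A) : C :=
  \sum_(a : A) ((v a : C)^* * (w a : C)).

Definition ret (A : finType) (a : A) : qvec A := [ffun b => (b == a)%:R].

Definition lin_ext (A B : finType) (f : A -> qvec B) (v : qvec A) : qvec B :=
  \sum_(a : A) v a *: f a.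

(* f is a morphism of the category of isometries. *)
Definition is_isometry (A B : finType) (f : A -> qvec B) : Prop :=
  forall v w : qvec A, inner (lin_ext f v) (lin_ext f w) = inner v w.

Fixpoint sem (G : ctx) (t : term C) (a : ty) (d : typing G t a) :
    den (ctx_ty G) -> qvec (den a) :=
  match d in typing G t a return den (ctx_ty G) -> qvec (den a) with
  | ty_var x a => fun g => ret (g.2 : den a)
  | ty_unit => fun=> ret (tt : den Q1)
  | ty_false => fun=> ret (false : den Q2)
  | ty_true => fun=> ret (true : den Q2)
  | ty_zero a => fun=> 0
  | ty_let G D GD x t u a b _ dt du => fun g =>
      \sum_(v : den a)
        sem dt (restr G g) v *: sem du ((restr D g, v) : den (ctx_ty ((x, a) :: D)))
  | ty_pair G D GD t u a b _ dt du => fun g =>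
      [ffun vw : den (Tensor a b) =>
        sem dt (restr G g) vw.1 * sem du (restr D g) vw.2]
  | ty_let_pair G D GD x y t u a b c _ dt du => fun g =>
      \sum_(v : den a) \sum_(w : den b)
        sem dt (restr G g) ((v, w) : den (Tensor a b)) *:
        sem du ((restr D g, v, w) : den (ctx_ty ((y, b) :: (x, a) :: D)))
  | ty_if G D GD c t u a _ dc dt du => fun g =>
      sem dc (restr G g) (true : den Q2) *: sem dt (restr D g)
      + sem dc (restr G g) (false : den Q2) *: sem du (restr D g)
  | ty_scale G k t a dt => fun g => k *: sem dt g
  | ty_plus G t u a dt du => fun g => sem dt g + sem du g
  | ty_wk_unit G x t a dt => fun g =>
      sem dt ((g, tt) : den (ctx_ty ((x, Q1) :: G)))
  | ty_wk_unit_inv G x t a _ dt => fun g => sem dt g.1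
  | ty_exch G G' t a _ dt => fun g => sem dt (restr G g)
  end.

(** * The quantum equational theory *)

(* [qax a t u]: the terms t and u are the two sides of an instance, at type a,
   of one of the equations.  The conditions on free variables implement the
   variable convention. *)
Inductive qax : ty -> term C -> term C -> Prop :=
  | ax_alpha a x y t u :
      y \notin fv (tLet (PVar x) tUnit u) ->
      capture_free (sub1 x (tVar y)) u ->
      qax a (tLet (PVar x) t u) (tLet (PVar y) t (subst (sub1 x (tVar y)) u))
  | ax_alpha_pair a x y x' y' t u :
      x' \notin fv (tLet (PPair x y) tUnit u) ->
      y' \notin fv (tLet (PPair x y) tUnit u) ->
      capture_free (sub2 x y (tVar x') (tVar y')) u ->
      qax a (tLet (PPair x y) t u)
            (tLet (PPair x' y') t (subst (sub2 x y (tVar x') (tVar y')) u))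
  | ax_let_val a x v u :
      is_val v -> capture_free (sub1 x v) u ->
      qax a (tLet (PVar x) v u) (subst (sub1 x v) u)
  | ax_let_pair_val a x y v w u :
      is_val v -> is_val w -> capture_free (sub2 x y v w) u ->
      qax a (tLet (PPair x y) (tPair v w) u) (subst (sub2 x y v w) u)
  | ax_let_pair a x y t u e :
      x \notin fv u ->
      qax a (tLet (PPair x y) (tPair t u) e)
            (tLet (PVar x) t (tLet (PVar y) u e))
  | ax_if_false a t u : qax a (tIf tFalse t u) u
  | ax_if_true a t u : qax a (tIf tTrue t u) t
  (* This classical equation is only for classical terms: for
     arbitrary t it would give () = (-1) * () and 0 = (). *)
  | ax_unit_eta t : classical t -> qax Q1 tUnit t
  | ax_let_eta a x t : qax a (tLet (PVar x) t (tVar x)) t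
  | ax_let_pair_eta a x y t :
      qax a (tLet (PPair x y) t (tPair (tVar x) (tVar y))) t
  | ax_if_eta a t : qax a (tIf t tTrue tFalse) t
  | ax_let_let a p q t u e :
      ~~ has (mem (pvars p)) (pvars q) ->
      ~~ has (mem (pvars p)) (fv u) -> ~~ has (mem (pvars q)) (fv t) ->
      qax a (tLet p t (tLet q u e)) (tLet q u (tLet p t e))
  | ax_let_if a p t u0 u1 e :
      qax a (tLet p (tIf t u0 u1) e) (tIf t (tLet p u0 e) (tLet p u1 e))
  | ax_if_lin a (l k : C) t0 t1 u0 u1 :
      qax a (tIf (tPlus (tScale l t0) (tScale k t1)) u0 u1)
            (tPlus (tScale l (tIf t0 u0 u1)) (tScale k (tIf t1 u0 u1)))
  | ax_plusC a t u : qax a (tPlus t u) (tPlus u t)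
  | ax_plus0 a t : qax a (tPlus t tZero) t
  | ax_plusA a t u v : qax a (tPlus t (tPlus u v)) (tPlus (tPlus t u) v)
  | ax_scaleDr a (l : C) t u :
      qax a (tScale l (tPlus t u)) (tPlus (tScale l t) (tScale l u))
  | ax_scaleDl a (l k : C) t :
      qax a (tPlus (tScale l t) (tScale k t)) (tScale (l + k) t)
  | ax_scale0 a t : qax a (tScale 0 t) tZero.

(* Equational reasoning on typed terms: [qeq G t u a] only relates terms that
   have type a in G; there is one congruence rule per typing rule. *)
Inductive qeq : ctx -> term C -> term C -> ty -> Prop :=
  | eq_ax G t u a : typing G t a -> typing G u a -> qax a t u -> qeq G t u a
  | eq_refl G t a : typing G t a -> qeq G t t a
  | eq_sym G t u a : qeq G t u a -> qeq G u t a
  | eq_trans G t u v a : qeq G t u a -> qeq G u v a -> qeq G t v a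
  | eq_let G D GD x t t' u u' a b :
      ctx_tensor G D = Some GD ->
      qeq G t t' a -> qeq ((x, a) :: D) u u' b ->
      qeq GD (tLet (PVar x) t u) (tLet (PVar x) t' u') b
  | eq_pair G D GD t t' u u' a b :
      ctx_tensor G D = Some GD ->
      qeq G t t' a -> qeq D u u' b ->
      qeq GD (tPair t u) (tPair t' u') (Tensor a b)
  | eq_let_pair G D GD x y t t' u u' a b c :
      ctx_tensor G D = Some GD ->
      qeq G t t' (Tensor a b) -> qeq ((y, b) :: (x, a) :: D) u u' c ->
      qeq GD (tLet (PPair x y) t u) (tLet (PPair x y) t' u') c
  | eq_if G D GD c c' t t' u u' a :
      ctx_tensor G D = Some GD ->
      qeq G c c' Q2 -> qeq D t t' a -> qeq D u u' a ->
      qeq GD (tIf c t u) (tIf c' t' u') a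
  | eq_scale G k t t' a : qeq G t t' a -> qeq G (tScale k t) (tScale k t') a
  | eq_plus G t t' u u' a :
      qeq G t t' a -> qeq G u u' a -> qeq G (tPlus t u) (tPlus t' u') a
  | eq_wk_unit G x t u a : qeq ((x, Q1) :: G) t u a -> qeq G t u a
  | eq_wk_unit_inv G x t u a :
      x \notin dom G -> qeq G t u a -> qeq ((x, Q1) :: G) t u a
  | eq_exch G G' t u a : perm_eq G G' -> qeq G t u a -> qeq G' t u a.

End Semantics.

(* Main.v *)
(** Weakening only affects variables of type Q1, whose value is unique. Hence the
    type at which each free occurrence of a variable is used is computed from
    the term and its expected type alone, going from the root to the leaves
    (the type of a let-bound variable is read off its uses), and a derivation
    has no freedom except for Q1-bindings. This yields a semantics [denote] of
    terms which does not mention derivations and agrees with [sem], and the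
    equations are sound for it in every environment. Intermediate terms of an
    equational proof may denote maps that are not isometries. *)

Require Import Defs.
From mathcomp Require Import all_boot all_order all_algebra.
From mathcomp Require Import reals complex.

Local Open Scope ring_scope.
Local Open Scope complex_scope.

Set Implicit Arguments.
Unset Strict Implicit.
Unset Printing Implicit Defensive.

Import GRing.Theory.

(** * Casts and the inferred type of a bound variable *)

Lemma den_castK (a : ty) (v : den a) : @den_cast a a v = v.
Proof. by rewrite /den_cast; case: eqP => // e; rewrite (eq_axiomK e). Qed.

Lemma den_Q1 (v w : den Q1) : v = w.
Proof. by case: v; case: w. Qed.

(* The type of the variable x whose typed occurrences are listed in o; a
   variable used only at type Q1, or not at all, can only be bound at Q1. *)
Definition infer (x : var) (o : seq (var * ty)) : ty :=
  head Q1 [seq b.2 | b <- o & (b.1 == x) && (b.2 != Q1)].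

Definition pat_ty (p : pat) (o : seq (var * ty)) : ty :=
  match p with
  | PVar x => infer x o
  | PPair x y => Tensor (infer x o) (infer y o)
  end.

(** For [a = Q1] the hypothesis leaves no occurrence at another type, and the default of [head] is
    the answer; otherwise some occurrence survives the filter and all survivors have type [a]. *)
Lemma infer_uniq (x : var) (a : ty) (o : seq (var * ty)) :
  (forall c, c != Q1 -> ((x, c) \in o) = (c == a)) -> infer x o = a.
Proof.
move=> H; rewrite /infer; case E: [seq b <- o | _] => [|[y c] s] /=.
  apply/eqP/negPn/negP => na.
  have na' : a != Q1 by rewrite eq_sym.
  have: (x, a) \in [seq b <- o | (b.1 == x) && (b.2 != Q1)].
    by rewrite mem_filter /= eqxx na' H // eqxx.
  by rewrite E.
have: (y, c) \in [seq b <- o | (b.1 == x) && (b.2 != Q1)] by rewrite E mem_head.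
rewrite mem_filter /= => /andP[/andP[/eqP-> nc]].
by rewrite H // => /eqP.
Qed.

Lemma infer_filter (x : var) (A : pred var) (o : seq (var * ty)) :
  A x -> infer x [seq b <- o | A b.1] = infer x o.
Proof.
move=> Ax; rewrite /infer -filter_predI; congr (head Q1 _); congr map.
apply: eq_filter => b /=; case: eqP => //= ->.
by rewrite Ax andbT.
Qed.

Lemma pat_ty_filter (p : pat) (o : seq (var * ty)) :
  pat_ty p [seq b <- o | b.1 \in pvars p] = pat_ty p o.
Proof.
have H x : x \in pvars p -> infer x [seq b <- o | b.1 \in pvars p] = infer x o.
  by move=> xp; apply: (infer_filter (A := fun z => z \in pvars p)).
by case: p H => [x|x y] H /=; rewrite !H // !inE eqxx ?orbT.
Qed.

Lemma infer_rename (x y : var) (f : var -> var) (o : seq (var * ty)) :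
  {in o, forall b, (f b.1 == y) = (b.1 == x)} ->
  infer y [seq (f b.1, b.2) | b <- o] = infer x o.
Proof.
move=> H; rewrite /infer filter_map -map_comp; congr (head _ _).
rewrite (@eq_in_filter _ _ (fun b => (b.1 == x) && (b.2 != Q1))) //.
by move=> b bo /=; rewrite H.
Qed.

(** * Typed occurrences of variables and their behaviour under substitution *)

Section Occurrences.
Variable C : Type.
Implicit Types (t u : term C) (s : var -> term C).

(* The free occurrences of variables in t, each with the type it must have for
   t to have type a. *)
Fixpoint occ t (a : ty) : seq (var * ty) :=
  match t with
  | tVar x => [:: (x, a)]
  | tUnit | tFalse | tTrue | tZero => [::]
  | tPair t u => if a is Tensor b c then occ t b ++ occ u c else [::]
  | tLet p t u =>
      occ t (pat_ty p (occ u a)) ++ [seq b <- occ u a | b.1 \notin pvars p]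
  | tIf c t u => occ c Q2 ++ occ t a ++ occ u a
  | tScale _ t => occ t a
  | tPlus t u => occ t a ++ occ u a
  end.

(* Occurrences of a bound variable at type Q1 are allowed whatever its inferred
   type is: [ty_wk_unit] hides such occurrences from the context. *)
Fixpoint well_typed t (a : ty) : bool :=
  match t with
  | tVar _ | tZero => true
  | tUnit => a == Q1
  | tFalse | tTrue => a == Q2
  | tPair t u =>
      if a is Tensor b c then well_typed t b && well_typed u c else false
  | tLet p t u =>
      [&& uniq (pvars p), well_typed t (pat_ty p (occ u a)), well_typed u a &
        all (fun b => (b.2 == Q1) || (b.2 == infer b.1 (occ u a))) (occ u a)]
  | tIf c t u => [&& well_typed c Q2, well_typed t a & well_typed u a]
  | tScale _ t => well_typed t a
  | tPlus t u => well_typed t a && well_typed u a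
  end.

Lemma occ_fv t a b : b \in occ t a -> b.1 \in fv t.
Proof.
elim: t a => //= [x|t IHt u IHu|p t IHt u IHu|
  c IHc t IHt u IHu|t IHt u IHu] a.
- by rewrite !inE => /eqP->.
- case: a => //= a c; rewrite !mem_cat => /orP[/IHt->//|/IHu->].
  by rewrite orbT.
- rewrite !mem_cat !mem_filter => /orP[/IHt->//|/andP[-> /IHu->]].
  by rewrite orbT.
- by rewrite !mem_cat => /or3P[/IHc|/IHt|/IHu] ->; rewrite ?orbT.
- by rewrite !mem_cat => /orP[/IHt|/IHu] ->; rewrite ?orbT.
Qed.

Lemma notin_fv_occ t a b : b \in occ t a -> forall x, x \notin fv t -> b.1 != x.
Proof. by move=> /occ_fv bt x; apply: contraNneq => <-. Qed.

Definition occ_subst_of s (o : seq (var * ty)) :=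
  flatten [seq occ (s b.1) b.2 | b <- o].

(** Absence of capture means that the terms put in for outer variables contain no variable of [p],
    while [shadow] fixes the variables of [p]. So substitution under the binder leaves the inferred
    type of [p] alone and changes only the occurrences that stay free. *)
Lemma filter_occ_shadow (p : pat) s (o : seq (var * ty)) :
  {in o, forall b, (b.1 \in pvars p) || ~~ has (mem (pvars p)) (fv (s b.1))} ->
  [seq b <- occ_subst_of (shadow p s) o | b.1 \in pvars p]
    = [seq b <- o | b.1 \in pvars p]
  /\ [seq b <- occ_subst_of (shadow p s) o | b.1 \notin pvars p]
    = occ_subst_of s [seq b <- o | b.1 \notin pvars p].
Proof.
rewrite /occ_subst_of; elim: o => //= b o IH H.
have [|IH1 IH2] := IH; first by move=> c co; apply: H; rewrite inE co orbT.
rewrite !filter_cat IH1 IH2 /shadow; have := H b (mem_head _ _).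
case: ifP => bp /=; rewrite ?bp /=; first by case: b bp {H}.
move=> dis.
have Hn : {in occ (s b.1) b.2, forall c, c.1 \notin pvars p}.
  by move=> c /occ_fv cs; apply: contra dis => cp; apply/hasP; exists c.1.
split.
  rewrite (eq_in_filter (a2 := pred0)) ?filter_pred0 // => c /Hn /negbTE -> //.
by rewrite (eq_in_filter (a2 := predT)) ?filter_predT // => c /Hn ->.
Qed.

Lemma capture_free_occ (p : pat) s u a :
  all (fun z => (z \in pvars p) || ~~ has (mem (pvars p)) (fv (s z))) (fv u) ->
  {in occ u a, forall b, (b.1 \in pvars p) || ~~ has (mem (pvars p)) (fv (s b.1))}.
Proof. by move=> /allP H b /occ_fv; apply: H. Qed.

Lemma occ_subst s t a :
  capture_free s t -> occ (subst s t) a = occ_subst_of s (occ t a).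
Proof.
rewrite /occ_subst_of.
elim: t s a => //= [x|t IHt u IHu|p t IHt u IHu|
  c IHc t IHt u IHu|t IHt u IHu] s a.
- by rewrite cats0.
- case/andP=> ct cu; case: a => //= b c.
  by rewrite IHt // IHu // map_cat flatten_cat.
- case/and3P=> ct cu /(@capture_free_occ _ _ _ a) dis.
  have [E1 E2] := filter_occ_shadow dis.
  rewrite IHt // IHu // -/(occ_subst_of _ _) E2 -pat_ty_filter E1 pat_ty_filter.
  by rewrite map_cat flatten_cat.
- by case/and3P=> cc ct cu; rewrite IHc // IHt // IHu // !map_cat !flatten_cat.
- by case/andP=> ct cu; rewrite IHt // IHu // map_cat flatten_cat.
Qed.

Lemma pat_ty_subst (p : pat) s u a :
  capture_free (shadow p s) u ->
  all (fun z => (z \in pvars p) || ~~ has (mem (pvars p)) (fv (s z))) (fv u) ->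
  pat_ty p (occ (subst (shadow p s) u) a) = pat_ty p (occ u a).
Proof.
move=> cu /(@capture_free_occ _ _ _ a) dis.
rewrite occ_subst // -pat_ty_filter.
by have [-> _] := filter_occ_shadow dis; rewrite pat_ty_filter.
Qed.

(** Each typed occurrence is a place where [s] puts a term, which must have the type recorded there
    for the result to be well typed. Under a binder, [shadow p s] agrees with [s] on the occurrences
    that stay free. *)
Lemma well_typed_subst s t a b :
  capture_free s t -> well_typed (subst s t) a -> b \in occ t a ->
  well_typed (s b.1) b.2.
Proof.
elim: t s a => //= [x|t IHt u IHu|p t IHt u IHu|
  c IHc t IHt u IHu|t IHt u IHu] s a.
- by rewrite inE => _ w /eqP->.
- case/andP=> ct cu; case: a => //= c d /andP[wt wu].
  by rewrite mem_cat => /orP[/IHt|/IHu]; apply.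
- case/and3P=> ct cu dis /and4P[_ wt wu _].
  rewrite pat_ty_subst // in wt.
  rewrite mem_cat mem_filter => /orP[/IHt|/andP[/negbTE bp /IHu]]; first exact.
  by move=> /(_ _ cu wu); rewrite /shadow bp.
- case/and3P=> cc ct cu /and3P[wc wt wu].
  by rewrite !mem_cat => /or3P[/IHc|/IHt|/IHu]; apply.
- case/andP=> ct cu /andP[wt wu].
  by rewrite mem_cat => /orP[/IHt|/IHu]; apply.
Qed.

Lemma is_val_classical t : is_val t -> classical t.
Proof. by elim: t => //= t IHt u IHu /andP[/IHt-> /IHu->]. Qed.

(** * Contexts, and what a typing derivation determines *)

Lemma mem_lookup (G : ctx) x a : lookup G x = Some a -> (x, a) \in G.
Proof.
elim: G => //= -[y b] G IH; case: eqP => [-> [->]|_ /IH xG]; first exact: mem_head.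
by rewrite inE xG orbT.
Qed.

Lemma lookup_None (G : ctx) x : lookup G x = None -> x \notin dom G.
Proof. by elim: G => //= -[y b] G IH; rewrite inE; case: eqP. Qed.

Lemma mem_dom (G : ctx) x a : (x, a) \in G -> x \in dom G.
Proof. exact: (map_f fst). Qed.

Lemma dom_uniq (G : ctx) x a b :
  uniq (dom G) -> (x, a) \in G -> (x, b) \in G -> a = b.
Proof.
elim: G => //= -[y c] G IH /= /andP[yG uG]; rewrite !inE.
case/orP=> [/eqP[xy ac]|xa]; case/orP=> [/eqP[xy' bc]|xb].
- by rewrite ac bc.
- by rewrite -xy (mem_dom xb) in yG.
- by rewrite -xy' (mem_dom xa) in yG.
- exact: IH.
Qed.

Lemma ctx_tensorP (G D GD : ctx) :
  uniq (dom G) -> uniq (dom D) -> ctx_tensor G D = Some GD ->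
  uniq (dom GD) /\ GD =i G ++ D.
Proof.
elim: G D GD => [|[x s] G IH] D GD /=; first by move=> _ uD [<-].
case/andP=> xG uG uD.
have mem_cons (E G' : ctx) : E =i G' -> ((x, s) :: E) =i (x, s) :: G'.
  by move=> e b; rewrite !inE e.
case E: (lookup D x) => [s'|].
  case: eqP => // e; rewrite -{s'}e in E.
  case ET: (ctx_tensor G _) => [H|] //= [<-].
  have uF : uniq (dom [seq b <- D | b.1 != x]).
    by rewrite /dom /unzip1 -(filter_map fst (fun y => y != x)) filter_uniq.
  have [uH mH] := IH _ _ uG uF ET; split=> /=.
    rewrite uH andbT; apply/negP => /mapP[[y b] + /= e]; rewrite -{y}e mH mem_cat.
    by case/orP=> [/mem_dom|]; [exact/negP | rewrite mem_filter /= eqxx].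
  move=> [y b]; rewrite !inE mH !mem_cat mem_filter /=.
  case: eqP => [->|ne] /=; last first.
    (* The filter removes from [D] only the binding of [x] to [s]: the variables of [D] are
       distinct, so [D] binds [x] to no other type. *)
    case: (eqVneq y x) => [yx|] //=; rewrite yx.
    case: ((x, b) \in G) => //=; apply/esym/negP => xb.
    by apply: ne; rewrite yx (dom_uniq uD xb (mem_lookup E)).
  by [].
case ET: (ctx_tensor G _) => [H|] //= [<-].
have [uH mH] := IH _ _ uG uD ET; split; last exact: mem_cons.
rewrite /= uH andbT; apply/negP => /mapP[[y b] + /= e]; rewrite -{y}e mH mem_cat.
by case/orP=> /mem_dom; apply/negP; rewrite ?xG ?(lookup_None E).
Qed.

(** Bindings at [Q1] come and go by weakening, so a term fixes its context only at the other types.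
    Comparing membership absorbs reordering and repeated uses of a variable. *)
Definition non_unit_ctx (o : seq (var * ty)) (G : ctx) : Prop :=
  uniq (dom G) /\ forall b, b.2 != Q1 -> (b \in o) = (b \in G).

Lemma infer_ctx o G x a : non_unit_ctx o G -> (x, a) \in G -> infer x o = a.
Proof.
move=> [uG oG] xG; apply: infer_uniq => c nc; rewrite oG //.
by apply/idP/eqP => [xc|->//]; apply: dom_uniq xc xG.
Qed.

Lemma infer_consistent o G :
  non_unit_ctx o G -> all (fun b => (b.2 == Q1) || (b.2 == infer b.1 o)) o.
Proof.
move=> H; apply/allP => -[x a] xo /=; case: (eqVneq a Q1) => //= na.
by rewrite (infer_ctx H (a := a)) // -(proj2 H).
Qed.

Lemma non_unit_ctx_tensor o o' G D GD :
  ctx_tensor G D = Some GD -> non_unit_ctx o G -> non_unit_ctx o' D ->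
  non_unit_ctx (o ++ o') GD.
Proof.
move=> e [uG oG] [uD oD]; have [uGD mGD] := ctx_tensorP uG uD e.
by split=> // b nb; rewrite mGD !mem_cat oG // oD.
Qed.

Lemma non_unit_ctx_bind (A : seq var) o (E D : ctx) :
  dom E =i A -> non_unit_ctx o (E ++ D) ->
  non_unit_ctx [seq b <- o | b.1 \notin A] D.
Proof.
move=> eA []; rewrite /dom /unzip1 map_cat cat_uniq => /and3P[_ /hasPn dis uD] oD.
split=> // b nb; rewrite mem_filter oD // mem_cat -eA.
case bD: (b \in D); first by rewrite orbT andbT; apply: dis; apply: map_f.
by rewrite orbF; apply/negP => /andP[/negP + bE]; apply; apply: map_f.
Qed.

(** By induction on the derivation: merging contexts matches concatenating occurrences, binding
    matches filtering, and the unit and exchange rules are invisible to [non_unit_ctx]. The inferred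
    type of a bound variable agrees with the one in the derivation by [infer_ctx]. *)
Lemma typing_occ (G : ctx) t a :
  typing G t a -> non_unit_ctx (occ t a) G /\ well_typed t a.
Proof.
elim=> {G t a} /=.
- by move=> x a; split=> //; split.
- by [].
- by [].
- by [].
- by [].
- move=> G D GD x t u a b e _ [oG wt] _ [oD wu].
  rewrite (infer_ctx oD (mem_head _ _)) wt wu (infer_consistent oD); split=> //.
  by apply: non_unit_ctx_tensor e oG (non_unit_ctx_bind (E := [:: (x, a)]) _ oD).
- move=> G D GD t u a b e _ [oG wt] _ [oD wu]; rewrite wt wu; split=> //.
  exact: non_unit_ctx_tensor e oG oD.
- move=> G D GD x y t u a b c e _ [oG wt] _ [oD wu].
  rewrite (infer_ctx oD (mem_head _ _)).
  rewrite (infer_ctx oD (x := x) (a := a)) ?inE ?eqxx ?orbT //.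
  rewrite wt wu (infer_consistent oD) !andbT; split.
    apply: non_unit_ctx_tensor e oG _.
    apply: (non_unit_ctx_bind (E := [:: (y, b); (x, a)])) oD => z.
    by rewrite !inE orbC.
  by case: oD => /= /andP[+ _] _; rewrite !inE negb_or eq_sym => /andP[].
- move=> G D GD c t u a e _ [oG wc] _ [oD wt] _ [oD' wu].
  rewrite wc wt wu; split=> //; apply: non_unit_ctx_tensor e oG _.
  by split=> [|b nb]; [exact: oD.1 | rewrite mem_cat oD.2 // oD'.2 // orbb].
- by [].
- move=> G t u a _ [oG wt] _ [oG' wu]; rewrite wt wu; split=> //.
  by split=> [|b nb]; [exact: oG.1 | rewrite mem_cat oG.2 // oG'.2 // orbb].
- move=> G x t a _ [[/= /andP[_ uG] oG] wt]; split=> //; split=> // b nb.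
  by rewrite oG // inE; case: (b =P (x, Q1)) nb => [->|] /=; rewrite ?eqxx.
- move=> G x t a xG _ [[uG oG] wt]; split=> //; split=> [|b nb]; first by rewrite /= xG.
  by rewrite oG // inE; case: (b =P (x, Q1)) nb => [->|] /=; rewrite ?eqxx.
- move=> G G' t a eG _ [[uG oG] wt]; split=> //; split=> [|b nb].
    by rewrite -(perm_uniq (perm_map fst eG)).
  by rewrite oG // (perm_mem eG).
Qed.

End Occurrences.

(** * Environments giving each variable a value at every type *)

Definition env := forall (x : var) (a : ty), den a.

(** The cast yields a default at any type other than the bound one; in a well-typed let this happens
    only at [Q1], where the value is unique. A pair pattern at a type that is not a tensor never
    arises from [pat_ty]. *)
Definition pat_get (p : pat) (a : ty) : den a -> env :=
  match p with
  | PVar _ => fun v y b => @den_cast a b v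
  | PPair _ x2 =>
      match a return den a -> env with
      | Tensor a1 a2 => fun v y b =>
          if y == x2 then @den_cast a2 b v.2 else @den_cast a1 b v.1
      | _ => fun _ y b => den_default b
      end
  end.

Definition bind (p : pat) (a : ty) (v : den a) (r : env) : env :=
  fun y b => if y \in pvars p then pat_get p v y b else r y b.

Definition env_of (G : ctx) (g : den (ctx_ty G)) : env :=
  fun x a => env_get x a g.

Lemma env_get_restr (G D : ctx) x a (g : den (ctx_ty G)) :
  uniq (dom D) -> (x, a) \in D -> env_get x a (restr D g) = env_get x a g.
Proof.
elim: D => //= -[y b] D IH /= /andP[yD uD]; rewrite inE xpair_eqE.
case: (x =P y) => [->|_] /=; last exact: IH.
by case/orP=> [/eqP->|/mem_dom]; [rewrite den_castK | rewrite (negbTE yD)].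
Qed.

(** * The denotation of terms without derivations, and its agreement with [sem] *)

Section Denotation.
Variable C : numClosedFieldType.
Implicit Types (t u : term C) (s : var -> term C) (r : env).

(* The value is meaningful only if t is [well_typed] at type a. *)
Fixpoint denote t (a : ty) (r : env) : qvec C (den a) :=
  match t with
  | tVar x => ret C (r x a)
  | tUnit | tFalse => ret C (den_default a)
  | tTrue => ret C (@den_cast Q2 a true)
  | tPair t u =>
      match a return qvec C (den a) with
      | Tensor b c => [ffun vw : den (Tensor b c) =>
          denote t b r vw.1 * denote u c r vw.2]
      | _ => 0
      end
  | tLet p t u =>
      \sum_(v : den (pat_ty p (occ u a)))
        denote t (pat_ty p (occ u a)) r v *: denote u a (bind p v r)
  | tIf c t u =>
      denote c Q2 r (true : den Q2) *: denote t a r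
      + denote c Q2 r (false : den Q2) *: denote u a r
  | tZero => 0
  | tScale k t => k *: denote t a r
  | tPlus t u => denote t a r + denote u a r
  end.

(** Moves the summation to [den b] along an equality of types, so that later sums can be compared
    without transports. *)
Lemma denote_let (p : pat) t u a b r :
  pat_ty p (occ u a) = b ->
  denote (tLet p t u) a r
    = \sum_(v : den b) denote t b r v *: denote u a (bind p v r).
Proof. by move=> <-. Qed.

Lemma denote_ext t a r r' :
  {in occ t a, forall b, r b.1 b.2 = r' b.1 b.2} ->
  denote t a r = denote t a r'.
Proof.
elim: t a r r' => //= [x|t IHt u IHu|p t IHt u IHu|
  c IHc t IHt u IHu|k t IHt|t IHt u IHu] a r r' H.
- by rewrite (H (x, a)) ?mem_head.
- case: a H => //= b c H; apply/ffunP => vw; rewrite !ffunE.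
  by rewrite (IHt _ r r') ?(IHu _ r r') // => d dt; apply: H; rewrite mem_cat dt ?orbT.
- apply: eq_bigr => v _; rewrite (IHt _ r r') => [|b bt]; last first.
    by apply: H; rewrite mem_cat bt.
  congr (_ *: _); apply: IHu => b bu; rewrite /bind; case: ifPn => // bp.
  by apply: H; rewrite mem_cat mem_filter bp bu orbT.
- rewrite (IHc _ r r') ?(IHt _ r r') ?(IHu _ r r') // => b bt;
    by apply: H; rewrite !mem_cat bt ?orbT.
- by rewrite (IHt _ r r').
- by rewrite (IHt _ r r') ?(IHu _ r r') // => b bt; apply: H; rewrite mem_cat bt ?orbT.
Qed.

Lemma denote_bind_notin (p : pat) t a b (v : den b) r :
  ~~ has (mem (pvars p)) (fv t) -> denote t a (bind p v r) = denote t a r.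
Proof.
move=> /hasPn dis; apply: denote_ext => c /occ_fv /dis /negbTE cp.
by rewrite /bind [_ \in _]cp.
Qed.

(** Substitution may copy or discard a term, which is sound for basis vectors but not for arbitrary
    ones. The terms put in are therefore required to denote basis vectors, at exactly the types at
    which the variables occur. *)
Lemma denote_subst s t a r r' :
  capture_free s t ->
  {in occ t a, forall b, denote (s b.1) b.2 r = ret C (r' b.1 b.2)} ->
  denote (subst s t) a r = denote t a r'.
Proof.
elim: t s a r r' => //= [x|t IHt u IHu|p t IHt u IHu|
  c IHc t IHt u IHu|k t IHt|t IHt u IHu] s a r r' cf H.
- by rewrite (H (x, a)) ?mem_head.
- case/andP: cf => ct cu; case: a H => //= b c H; apply/ffunP => vw; rewrite !ffunE.
  by rewrite (IHt _ _ r r') ?(IHu _ _ r r') // => d dt;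
    apply: H; rewrite mem_cat dt ?orbT.
- case/and3P: cf => ct cu dis.
  rewrite (pat_ty_subst a cu dis); apply: eq_bigr => v _.
  rewrite (IHt _ _ r r') // => [|b bt]; last by apply: H; rewrite mem_cat bt.
  congr (_ *: _); apply: IHu => // b bu.
  (* A variable of [p] is left in place by [shadow]; for any other variable the substituted term
     avoids [p], so the new binding does not change its meaning. *)
  rewrite {2}/bind /shadow; case: ifPn => bp /=; first by rewrite /bind bp.
  rewrite denote_bind_notin; first by apply: H; rewrite mem_cat mem_filter bp bu orbT.
  by have := allP dis _ (occ_fv bu); rewrite (negbTE bp).
- case/and3P: cf => cc ct cu.
  rewrite (IHc _ _ r r') ?(IHt _ _ r r') ?(IHu _ _ r r') // => b bt;
    by apply: H; rewrite !mem_cat bt ?orbT.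
- by rewrite (IHt _ _ r r').
- case/andP: cf => ct cu.
  by rewrite (IHt _ _ r r') ?(IHu _ _ r r') // => b bt;
    apply: H; rewrite mem_cat bt ?orbT.
Qed.

Lemma sum_ret (A B : finType) (w : A) (F : A -> qvec C B) :
  \sum_(v : A) ret C w v *: F v = F w.
Proof.
rewrite (bigD1 w) //= ffunE eqxx scale1r big1 ?addr0 // => v /negbTE nv.
by rewrite ffunE nv scale0r.
Qed.

Lemma sum_ret_r (A : finType) (f : qvec C A) : \sum_(v : A) f v *: ret C v = f.
Proof.
apply/ffunP => w; rewrite sum_ffunE (bigD1 w) //= !ffunE eqxx [_ *: _]mulr1.
rewrite big1 ?addr0 // => v /negbTE vw.
by rewrite !ffunE eq_sym vw [_ *: _]mulr0.
Qed.

Lemma ret_pair (A B : finType) (v : A) (w : B) :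
  [ffun vw : A * B => ret C v vw.1 * ret C w vw.2] = ret C (v, w).
Proof.
by apply/ffunP => -[x y]; rewrite !ffunE xpair_eqE /= -natrM mulnb.
Qed.

(** In a let only one coefficient is nonzero, and a conditional on a basis vector selects one
    branch. Well-typedness excludes a pair at a type that is not a tensor, which would denote
    zero. *)
Lemma classical_denote t a r :
  classical t -> well_typed t a -> exists w, denote t a r = ret C w.
Proof.
elim: t a r => //= [x||t IHt u IHu|p t IHt u IHu|
  c IHc t IHt u IHu||] a r.
- by exists (r x a).
- by exists (den_default a).
- case/andP=> ct cu; case: a => //= b c /andP[wt wu].
  have [v ->] := IHt _ r ct wt; have [w ->] := IHu _ r cu wu.
  by exists (v, w); rewrite -ret_pair.
- case/andP=> ct cu /and4P[_ wt wu _]; have [v ->] := IHt _ r ct wt.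
  by rewrite sum_ret; apply: IHu.
- case/and3P=> cc ct cu /and3P[wc wt wu].
  have [[] ->] := IHc _ r cc wc; rewrite !ffunE /= scale1r scale0r ?addr0 ?add0r.
    exact: IHt.
  exact: IHu.
- by exists (den_default a).
- by exists (@den_cast Q2 a true).
Qed.

(** By induction on the derivation. The environments to be compared agree on every typed occurrence:
    at [Q1] because the value is unique, at other types because [typing_occ] places the binding in
    the context, where restriction preserves it. *)
Lemma sem_denote (G : ctx) t a (d : typing G t a) (g : den (ctx_ty G)) :
  sem d g = denote t a (env_of g).
Proof.
have occ_ctx D (t' : term C) b : typing D t' b ->
  forall z c, c != Q1 -> (z, c) \in occ t' b -> uniq (dom D) /\ (z, c) \in D.
  by case/typing_occ=> -[uD oD] _ z c nc zt; rewrite -oD.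
have restr_ext (D D' : ctx) (t' : term C) b (d' : typing D' t' b) (h : den (ctx_ty D)) :
  denote t' b (env_of (restr D' h)) = denote t' b (env_of h).
  apply: denote_ext => -[z c] zt; case: (eqVneq c Q1) zt => [->|nc] zt.
    exact: den_Q1.
  by have [uD zD] := occ_ctx _ _ _ d' _ _ nc zt; apply: env_get_restr.
elim: d g => {G t a} /=.
- by move=> x a g; rewrite /env_of /= eqxx den_castK.
- by [].
- by [].
- by move=> g; rewrite den_castK.
- by [].
- move=> G D GD x t u a b e dt IHt du IHu g.
  have [oD _] := typing_occ du.
  rewrite (infer_ctx oD (mem_head _ _)); apply: eq_bigr => v _.
  rewrite IHt IHu (restr_ext _ _ _ _ dt); congr (_ *: _).
  apply: denote_ext => -[z c] zu; case: (eqVneq c Q1) zu => [->|nc] zu.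
    exact: den_Q1.
  have [/= /andP[_ uD]] := occ_ctx _ _ _ du _ _ nc zu.
  rewrite /bind /env_of /= !inE xpair_eqE; case: eqP => //= _.
  exact: env_get_restr.
- move=> G D GD t u a b e dt IHt du IHu g; apply/ffunP => vw.
  by rewrite !ffunE IHt IHu !restr_ext.
- move=> G D GD x y t u a b c e dt IHt du IHu g.
  have [oD _] := typing_occ du.
  rewrite (infer_ctx oD (mem_head _ _)).
  rewrite (infer_ctx oD (x := x) (a := a)) ?inE ?eqxx ?orbT //.
  rewrite pair_bigA; apply: eq_bigr => -[v w] _.
  rewrite IHt IHu (restr_ext _ _ _ _ dt); congr (_ *: _).
  apply: denote_ext => -[z k] zu; case: (eqVneq k Q1) zu => [->|nk] zu.
    exact: den_Q1.
  have [/= /and3P[_ _ uD]] := occ_ctx _ _ _ du _ _ nk zu.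
  rewrite /bind /env_of /= !inE !xpair_eqE.
  case: (z =P y) => [_|_]; first by rewrite orbT.
  case: (z =P x) => //= _.
  exact: env_get_restr.
- by move=> G D GD c t u a e dc IHc dt IHt du IHu g; rewrite IHc IHt IHu !restr_ext.
- by move=> G k t a dt IHt g; rewrite IHt.
- by move=> G t u a dt IHt du IHu g; rewrite IHt IHu.
- move=> G x t a dt IHt g; rewrite IHt.
  apply: denote_ext => -[z c] zt; case: (eqVneq c Q1) zt => [->|nc] zt.
    exact: den_Q1.
  (* An occurrence at a type other than [Q1] lies in [G], whose variables differ from the hidden
     [x], so dropping [x] from the environment leaves its value unchanged. *)
  have [/= /andP[xG _]] := occ_ctx _ _ _ dt _ _ nc zt.
  rewrite inE xpair_eqE (negbTE nc) andbF /= /env_of /= => /mem_dom zG.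
  by case: eqP zG => // ->; rewrite (negbTE xG).
- move=> G x t a xG dt IHt g; rewrite IHt.
  apply: denote_ext => -[z c] zt; case: (eqVneq c Q1) zt => [->|nc] zt.
    exact: den_Q1.
  have [_ /mem_dom zG] := occ_ctx _ _ _ dt _ _ nc zt.
  by rewrite /env_of /=; case: eqP zG => // ->; rewrite (negbTE xG).
- by move=> G G' t a eG dt IHt g; rewrite IHt restr_ext.
Qed.

(** * Soundness of the individual equations *)

Lemma denote_rename (p q : pat) (f : var -> var) s t u a r :
  (forall z, s z = tVar (f z)) -> capture_free s u ->
  pat_ty q [seq (f b.1, b.2) | b <- occ u a] = pat_ty p (occ u a) ->
  (forall b (v : den (pat_ty p (occ u a))), b \in occ u a ->
     bind q v r (f b.1) b.2 = bind p v r b.1 b.2) ->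
  denote (tLet p t u) a r = denote (tLet q t (subst s u)) a r.
Proof.
move=> sf cf e H.
have E : pat_ty q (occ (subst s u) a) = pat_ty p (occ u a).
  rewrite occ_subst // -e /occ_subst_of; congr (pat_ty q _).
  by elim: (occ u a) => //= b o ->; rewrite sf.
rewrite (denote_let _ _ erefl) (denote_let _ _ E).
apply: eq_bigr => v _; congr (_ *: _); apply/esym/denote_subst => // b bu.
by rewrite sf /= H.
Qed.

(** A bound variable may occur at [Q1] besides its inferred type; there the value denotes the only
    basis vector, which is also what the cast gives. *)
Lemma denote_val_at v a b (w : den a) r :
  is_val v -> denote v a r = ret C w -> well_typed v b ->
  (b == Q1) || (b == a) -> denote v b r = ret C (@den_cast a b w).
Proof.
move=> vv e wv /orP[/eqP eb|/eqP eb]; last by subst b; rewrite e den_castK.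
subst b; have [w' ->] := classical_denote r (is_val_classical vv) wv.
by rewrite (den_Q1 w' (den_cast _ w)).
Qed.

Lemma well_typed_occ p t u a b :
  well_typed (tLet p t u) a -> b \in occ u a ->
  (b.2 == Q1) || (b.2 == infer b.1 (occ u a)).
Proof. by case/and4P=> _ _ _ /allP; apply. Qed.

Lemma infer_cat x o o' : {in o, forall b, b.1 != x} -> infer x (o ++ o') = infer x o'.
Proof.
move=> H; rewrite /infer filter_cat.
rewrite (eq_in_filter (a2 := pred0)) ?filter_pred0 // => b /H /negbTE /= -> //.
Qed.

Lemma denote_alpha x y t u a r :
  y \notin fv (tLet (PVar x) tUnit u) -> capture_free (sub1 x (tVar y)) u ->
  denote (tLet (PVar x) t u) a r
    = denote (tLet (PVar y) t (subst (sub1 x (tVar y)) u)) a r.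
Proof.
rewrite [fv _]/= mem_filter inE negb_and negbK => yu cf.
pose f z := if z == x then y else z.
(* Freshness allows [y] to be [x] itself; otherwise [y] does not occur free in [u]. *)
have fy b : b \in occ u a -> (f b.1 == y) = (b.1 == x).
  move=> /occ_fv bu; rewrite /f; case: (b.1 =P x) => [|bx]; first by rewrite eqxx.
  apply/negbTE/eqP => e; case/orP: yu => [/eqP yx|]; last by rewrite -e bu.
  by apply: bx; rewrite e.
apply: (denote_rename (f := f)) => //.
- by move=> z; rewrite /sub1 /f; case: eqP.
- exact: infer_rename fy.
- by move=> b v bu; rewrite /bind !inE fy // /f; case: eqP.
Qed.

(** The new names may reuse the old ones, even swapped. Distinctness within both pairs and freshness
    make the simultaneous renaming injective on the occurrences in [u]. *)
Lemma denote_alpha_pair x y x' y' t u a r :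
  x' \notin fv (tLet (PPair x y) tUnit u) ->
  y' \notin fv (tLet (PPair x y) tUnit u) ->
  capture_free (sub2 x y (tVar x') (tVar y')) u -> x != y -> x' != y' ->
  denote (tLet (PPair x y) t u) a r
    = denote (tLet (PPair x' y') t (subst (sub2 x y (tVar x') (tVar y')) u)) a r.
Proof.
rewrite [fv _]/= !mem_filter !inE !negb_and !negbK => xu yu cf xy xy'.
pose f z := if z == x then x' else if z == y then y' else z.
have fresh z b : (z == x) || (z == y) || (z \notin fv u) -> b \in occ u a ->
    b.1 != x -> b.1 != y -> b.1 == z = false.
  move=> zu /occ_fv bu bx bY; apply/negbTE; apply: contraTneq zu => e.
  by rewrite -e (negbTE bx) (negbTE bY) bu.
have fx b : b \in occ u a -> (f b.1 == x') = (b.1 == x).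
  move=> bu; rewrite /f; case: (eqVneq b.1 x) => [|bx]; first by rewrite eqxx.
  by case: (eqVneq b.1 y) => [|bY]; [rewrite eq_sym (negbTE xy') | apply: fresh].
have fY b : b \in occ u a -> (f b.1 == y') = (b.1 == y).
  move=> bu; rewrite /f; case: (eqVneq b.1 x) => [->|bx].
    by rewrite (negbTE xy) (negbTE xy').
  by case: (eqVneq b.1 y) => [|bY]; [rewrite eqxx | apply: fresh].
apply: (denote_rename (f := f)) => //.
- by move=> z; rewrite /sub2 /f; case: eqP => // _; case: eqP.
- by rewrite /= (infer_rename fx) (infer_rename fY).
- move=> b v bu; rewrite /bind !inE fx // fY //= fY //.
  by rewrite /f; case: eqP => //=; case: eqP.
Qed.

(** The value denotes a basis vector, so the sum collapses to a single environment. Well-typedness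
    of the result makes the value typable at each occurrence of [x], where [denote_val_at] evaluates
    it. *)
Lemma denote_let_val x v u a r :
  is_val v -> capture_free (sub1 x v) u ->
  well_typed (tLet (PVar x) v u) a -> well_typed (subst (sub1 x v) u) a ->
  denote (tLet (PVar x) v u) a r = denote (subst (sub1 x v) u) a r.
Proof.
move=> vv cf wl wr; have [_ wv _ _] := and4P wl.
have [w e] := classical_denote r (is_val_classical vv) wv.
rewrite /= e sum_ret; apply/esym/denote_subst => // -[z c] zu.
have := well_typed_subst cf wr zu.
rewrite /bind /sub1 /= inE; case: (eqVneq z x) => //= zx wz; subst z.
exact: denote_val_at e wz (well_typed_occ wl zu).
Qed.

Lemma denote_let_pair_val x y v w u a r :
  is_val v -> is_val w -> capture_free (sub2 x y v w) u ->
  well_typed (tLet (PPair x y) (tPair v w) u) a ->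
  well_typed (subst (sub2 x y v w) u) a ->
  denote (tLet (PPair x y) (tPair v w) u) a r
    = denote (subst (sub2 x y v w) u) a r.
Proof.
move=> vv vw cf wl wr; have [/= xy /andP[wv ww] _ _] := and4P wl.
have [k ek] := classical_denote r (is_val_classical vv) wv.
have [l el] := classical_denote r (is_val_classical vw) ww.
rewrite /= ek el ret_pair sum_ret; apply/esym/denote_subst => // -[z c] zu.
have := well_typed_subst cf wr zu; have := well_typed_occ wl zu.
rewrite /bind /sub2 /= !inE; case: (eqVneq z x) => [->|zx] /=.
  move: xy; rewrite inE andbT => /negbTE -> zc wz.
  exact: denote_val_at ek wz zc.
by case: (eqVneq z y) => //= -> zc wz; apply: denote_val_at el wz zc.
Qed.

(** Since [x] is not free in [u], neither its inferred type nor the meaning of [u] changes under the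
    nested binding, and the iterated sum is a sum over pairs. *)
Lemma denote_let_pair x y t u e a r :
  x \notin fv u -> x != y ->
  denote (tLet (PPair x y) (tPair t u) e) a r
    = denote (tLet (PVar x) t (tLet (PVar y) u e)) a r.
Proof.
move=> xu xy.
have E : infer x (occ (tLet (PVar y) u e) a) = infer x (occ e a).
  rewrite /= infer_cat => [|b /notin_fv_occ]; last exact.
  by apply: (infer_filter (A := fun z => z \notin [:: y])); rewrite inE.
rewrite (denote_let (p := PVar x) _ _ E) /=.
rewrite (eq_bigr (fun v => \sum_(w : den (infer y (occ e a)))
    denote t _ r v *: (denote u (infer y (occ e a)) r w *:
      denote e a (bind (PVar y) w (bind (PVar x) v r))))); last first.
  move=> v _; rewrite scaler_sumr; apply: eq_bigr => w _.
  rewrite denote_bind_notin //; apply/hasPn => z zu /=.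
  by rewrite inE; apply: contraNneq xu => <-.
rewrite pair_bigA; apply: eq_bigr => -[v w] _ /=.
rewrite ffunE scalerA; congr (_ *: _); apply: denote_ext => b _.
rewrite /bind !inE /=; case: (eqVneq b.1 y) => [|_]; first by rewrite orbT.
by rewrite orbF.
Qed.

(** Exchange of finite sums: neither pattern reaches the other bound term, so the inferred types are
    unaffected, and bindings of disjoint patterns commute. *)
Lemma denote_let_let p q t u e a r :
  ~~ has (mem (pvars p)) (pvars q) ->
  ~~ has (mem (pvars p)) (fv u) -> ~~ has (mem (pvars q)) (fv t) ->
  denote (tLet p t (tLet q u e)) a r = denote (tLet q u (tLet p t e)) a r.
Proof.
have occ_inner p' q' u' : ~~ has (mem (pvars p')) (pvars q') ->
    ~~ has (mem (pvars p')) (fv u') ->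
    pat_ty p' (occ (tLet q' u' e) a) = pat_ty p' (occ e a).
  move=> /hasPn pq /hasPn pu; rewrite -pat_ty_filter /= filter_cat.
  rewrite (eq_in_filter (a2 := pred0)) ?filter_pred0 /=; last first.
    by move=> b /occ_fv /pu /negbTE.
  rewrite -filter_predI -[RHS]pat_ty_filter; congr pat_ty; apply: eq_filter => b /=.
  by case bp: (b.1 \in pvars p') => //=; apply: contraL bp => /pq.
move=> pq pu qt; have qp : ~~ has (mem (pvars q)) (pvars p).
  by rewrite has_sym.
rewrite (denote_let _ _ (occ_inner p q u pq pu)).
rewrite (denote_let _ _ (occ_inner q p t qp qt)) /=.
under eq_bigr do rewrite scaler_sumr.
under [RHS]eq_bigr do rewrite scaler_sumr.
rewrite exchange_big; apply: eq_bigr => w _; apply: eq_bigr => v _.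
rewrite (denote_bind_notin _ _ _ pu) (denote_bind_notin _ _ _ qt).
rewrite !scalerA mulrC; congr (_ *: _).
apply: denote_ext => b _; rewrite /bind.
case bp: (b.1 \in pvars p) => //.
by have /= /negbTE -> := hasPn qp _ bp.
Qed.

Lemma qax_sound a t u r :
  qax a t u -> well_typed t a -> well_typed u a -> denote t a r = denote u a r.
Proof.
case=> {a t u}.
- by move=> *; apply: denote_alpha.
- move=> a x y x' y' t u xu yu cf /and4P[/= xy _ _ _] /and4P[/= xy' _ _ _].
  by apply: denote_alpha_pair => //; move: xy xy'; rewrite !inE !andbT.
- by move=> *; apply: denote_let_val.
- by move=> *; apply: denote_let_pair_val.
- move=> a x y t u e xu /and4P[/= xy _ _ _] _; apply: denote_let_pair => //.
  by move: xy; rewrite inE andbT.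
- by move=> a t u _ _; rewrite /= !ffunE /= scale0r scale1r add0r.
- by move=> a t u _ _; rewrite /= den_castK !ffunE /= scale0r scale1r addr0.
(* Classicality makes [t] denote a basis vector, and [Q1] has only one. *)
- move=> t ct _ wt; have [w ->] := classical_denote r ct wt.
  by rewrite /= (den_Q1 w tt).
- move=> a x t _ _.
  have e : pat_ty (PVar x) (occ (tVar x : term C) a) = a.
    (* At [Q1] the occurrence is skipped by [infer], whose default is then the right type. *)
    by rewrite /= /infer /= eqxx; case: eqP.
  rewrite (denote_let _ _ e) -[RHS]sum_ret_r; apply: eq_bigr => v _.
  by rewrite /= /bind !inE eqxx /= den_castK.
- move=> a x y t /and4P[xy _ wp _] _; case: a wp => // a b _.
  have {}xy : x == y = false by move: xy; rewrite /= inE andbT => /negbTE.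
  have yx : y == x = false by rewrite eq_sym.
  have e : pat_ty (PPair x y) (occ (tPair (tVar x) (tVar y) : term C) (Tensor a b))
      = Tensor a b.
    rewrite /= /infer /= !eqxx xy yx /=.
    by case: (a =P Q1) (b =P Q1) => [->|_] [->|_].
  rewrite (denote_let _ _ e) -[RHS]sum_ret_r; apply: eq_bigr => -[v w] _.
  rewrite /= ret_pair /bind !inE !eqxx orbT /= xy.
  by rewrite eqxx !den_castK.
(* The branch [tTrue] is well typed only at [Q2], which fixes [a]. *)
- move=> a t /and3P[_ wt _] _; move/eqP: wt => ->.
  rewrite /= den_castK; apply/ffunP => -[]; rewrite !ffunE /=.
    by rewrite [_ *: _]mulr1 [_ *: _]mulr0 addr0.
  by rewrite scaler0 [_ *: _]mulr1 add0r.
- by move=> *; apply: denote_let_let.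
- move=> a p t u0 u1 e _ _ /=; rewrite !scaler_sumr -big_split.
  by apply: eq_bigr => v _; rewrite !ffunE /= scalerDl !scalerA.
- move=> a l k t0 t1 u0 u1 _ _ /=; rewrite !ffunE !scalerDl !scalerDr !scalerA.
  by rewrite addrACA.
- by move=> a t u _ _ /=; rewrite addrC.
- by move=> a t _ _ /=; rewrite addr0.
- by move=> a t u v _ _ /=; rewrite addrA.
- by move=> a l t u _ _ /=; rewrite scalerDr.
- by move=> a l k t _ _ /=; rewrite scalerDl.
- by move=> a t _ _ /=; rewrite scale0r.
Qed.

(** * Soundness of equational reasoning *)

Lemma qeq_typing (G : ctx) t u a :
  qeq G t u a -> inhabited (typing G t a) /\ inhabited (typing G u a).
Proof.
elim=> {G t u a}.
- by move=> G t u a dt du _; split; constructor.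
- by move=> G t a dt; split; constructor.
- by move=> G t u a _ [].
- by move=> G t u v a _ [dt _] _ [_ dv].
- move=> G D GD x t t' u u' a b e _ [[dt] [dt']] _ [[du] [du']].
  by split; constructor; [exact: ty_let e dt du | exact: ty_let e dt' du'].
- move=> G D GD t t' u u' a b e _ [[dt] [dt']] _ [[du] [du']].
  by split; constructor; [exact: ty_pair e dt du | exact: ty_pair e dt' du'].
- move=> G D GD x y t t' u u' a b c e _ [[dt] [dt']] _ [[du] [du']].
  by split; constructor; [exact: ty_let_pair e dt du | exact: ty_let_pair e dt' du'].
- move=> G D GD c c' t t' u u' a e _ [[dc] [dc']] _ [[dt] [dt']] _ [[du] [du']].
  by split; constructor; [exact: ty_if e dc dt du | exact: ty_if e dc' dt' du'].
- by move=> G k t t' a _ [[dt] [dt']]; split; constructor; apply: ty_scale.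
- move=> G t t' u u' a _ [[dt] [dt']] _ [[du] [du']].
  by split; constructor; apply: ty_plus.
- by move=> G x t u a _ [[dt] [du]]; split; constructor; apply: ty_wk_unit (x) _ _ _.
- by move=> G x t u a xG _ [[dt] [du]]; split; constructor; apply: ty_wk_unit_inv.
- by move=> G G' t u a e _ [[dt] [du]]; split; constructor; apply: ty_exch e _.
Qed.

(** Because [denote] mentions no context and the claim covers all environments, the unit and
    exchange rules need no argument, and transitivity may pass through arbitrary intermediate
    terms. *)
Lemma qeq_sound (G : ctx) t u a :
  qeq G t u a -> forall r, denote t a r = denote u a r.
Proof.
elim=> {G t u a}.
- move=> G t u a dt du ax r.
  by apply: qax_sound ax _ _; [case: (typing_occ dt) | case: (typing_occ du)].
- by [].
- by [].
- by move=> G t u v a _ IHt _ IHu r; rewrite IHt.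
- move=> G D GD x t t' u u' a b _ _ IHt
    /qeq_typing[[/typing_occ[ou _]] [/typing_occ[ou' _]]] IHu r.
  (* The occurrences in [u] and [u'] may differ, but both are typed in one context, so the same type
     is inferred for [x] and both sums have one index set. *)
  have e o : non_unit_ctx o ((x, a) :: D) -> pat_ty (PVar x) o = a.
    by move=> oD; apply: infer_ctx oD (mem_head _ _).
  rewrite (denote_let _ _ (e _ ou)) (denote_let _ _ (e _ ou')).
  by apply: eq_bigr => v _; rewrite IHt IHu.
- move=> G D GD t t' u u' a b _ _ IHt _ IHu r.
  by rewrite /=; apply/ffunP => vw; rewrite !ffunE IHt IHu.
- move=> G D GD x y t t' u u' a b c _ _ IHt
    /qeq_typing[[/typing_occ[ou _]] [/typing_occ[ou' _]]] IHu r.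
  have ab o : non_unit_ctx o [:: (y, b), (x, a) & D] ->
      pat_ty (PPair x y) o = Tensor a b.
    move=> od; rewrite /= (infer_ctx od (mem_head _ _)).
    by rewrite (infer_ctx od (x := x) (a := a)) ?inE ?eqxx ?orbT.
  rewrite (denote_let _ _ (ab _ ou)) (denote_let _ _ (ab _ ou')).
  by apply: eq_bigr => v _; rewrite IHt IHu.
- by move=> G D GD c c' t t' u u' a _ _ IHc _ IHt _ IHu r; rewrite /= IHc IHt IHu.
- by move=> G k t t' a _ IHt r; rewrite /= IHt.
- by move=> G t t' u u' a _ IHt _ IHu r; rewrite /= IHt IHu.
- by [].
- by [].
- by [].
Qed.

End Denotation.

Theorem lemma6p2 (R : realType) (G : ctx) (a : ty) (t u : term R[i])
    (dt : typing G t a) (du : typing G u a)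
    (isot : is_isometry (sem dt)) (isou : is_isometry (sem du)) :
  qeq G t u a -> forall g : den (ctx_ty G), sem dt g = sem du g.
Proof. by move=> tu g; rewrite !sem_denote (qeq_sound tu). Qed.
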